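(* Let $\alpha,\mu,\sigma>0$ satisfy $4\alpha\mu\ge\sigma^2$ and let $\Delta>0$. For $\theta\ge1$ let $(X_n)_{n\ge0}$ be the $\theta$-Milstein approximation of the CIR equation with step size $\Delta$ and initial value $X_0\ge0$. Say that the scheme preserves the long-term second moment of the exact solution $X(t)$ if $$\lim_{n\to\infty}\mathbb{E}[X_n^2]=\lim_{t\to\infty}\mathbb{E}[X(t)^2]=\mu^2+\frac{\sigma^2\mu}{2\alpha}.$$ Then: (i) the fully implicit Milstein scheme ($\theta=1$) preserves the long-term second moment if and only if $4\alpha\mu=\sigma^2$; (ii) if $4\alpha\mu>\sigma^2$, then for no $\theta\ge1$ does the $\theta$-Milstein scheme preserve the long-term second moment.
   Context: The CIR equation is the SDE $dX(t)=\alpha(\mu-X(t))\,dt+\sigma\sqrt{X(t)}\,dW(t)$, where $\alpha,\mu,\sigma$ are positive constants and $W$ is a standard Wiener process; for $X(0)=X_0\ge0$ it has a unique non-negative strong solution $X(t)$, and it is known that $\lim_{t\to\infty}\mathbb{E}[X(t)^2]=\mu^2+\frac{\sigma^2\mu}{2\alpha}$. The $\theta$-Milstein scheme for it with step size $\Delta>0$, $t_n=n\Delta$ and $\Delta W_n=W(t_{n+1})-W(t_n)$, is $$X_{n+1}=\frac{1}{1+\alpha\theta\Delta}\left\{(1-\alpha\Delta+\alpha\theta\Delta)X_n+\left(\alpha\mu-\frac{\sigma^2}{4}\right)\Delta+\sigma\sqrt{X_n}\,\Delta W_n+\frac{\sigma^2}{4}\Delta W_n^2\right\};$$ for $\theta\ge1$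 and $4\alpha\mu\ge\sigma^2$ the iterates are non-negative, so the scheme is well defined. The initial value $X_0\ge0$ is deterministic or random, independent of $W$, with $\mathbb{E}[X_0^2]<\infty$. *)

(* Defs.v *)
From HB Require Import structures.
From mathcomp Require Import all_boot all_order all_algebra.
From mathcomp Require Import all_classical all_reals all_analysis.

Set Implicit Arguments.
Unset Strict Implicit.
Unset Printing Implicit Defensive.

Import Order.TTheory GRing.Theory Num.Theory.
Import numFieldNormedType.Exports.

Local Open Scope classical_set_scope.
Local Open Scope ring_scope.

Section processes.
Context {d : measure_display} {T : measurableType d} {R : realType}.
Variable P : probability T R.

Definition preimages (Z : T -> R) : set (set T) :=
  preimage_set_system setT Z measurable.

(* the sigma-algebra generated by the variables Z s, s \in D *)
Definition sigma_of (D : set R) (Z : R -> T -> R) : set (set T) :=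
  <<s \bigcup_(s in D) preimages (Z s) >>.

Definition independent (F G : set (set T)) : Prop :=
  forall A B, F A -> G B -> P (A `&` B) = (P A * P B)%E.

Definition continuous_paths (Z : R -> T -> R) : Prop :=
  {ae P, forall w, {within `[0, +oo[, continuous (fun t => Z t w)}}.

(* Processes are indexed by all of R, but only the times t >= 0 matter.
   The second argument of [normal_prob] is the standard deviation. *)
Record wiener_process (W : R -> {RV P >-> R}) : Prop := WienerProcess {
  wiener_start : {ae P, forall w, W 0 w = 0} ;
  wiener_indep_increments : forall s t : R, 0 <= s -> s < t ->
    independent (sigma_of `[0, s] W) (preimages (W t \- W s)) ;
  wiener_normal_increments : forall s t : R, 0 <= s -> s < t ->
    forall B : set R, measurable B ->
      P ((W t \- W s) @^-1` B) = normal_prob 0 (Num.sqrt (t - s)) B ;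
  wiener_continuous : continuous_paths W }.

Definition cvg_in_probability (S : nat -> T -> R) (Z : T -> R) : Prop :=
  forall e : R, 0 < e ->
    P [set w | e <= `|S n w - Z w|] @[n --> \oo] --> 0%E.

Definition left_sum (W H : R -> T -> R) (t : R) (n : nat) (w : T) : R :=
  let u i := i%:R * t / n%:R in
  \sum_(i < n) H (u i) w * (W (u i.+1) w - W (u i) w).

(* Z is the Ito integral of H dW over [0, t]. For H adapted with continuous
   paths, this integral is the limit in probability of left-point sums; the
   limit does not depend on the partitions, taken uniform here. *)
Definition ito_integral (W H : R -> T -> R) (t : R) (Z : T -> R) : Prop :=
  cvg_in_probability (left_sum W H t) Z.

(* the filtration of (X0, W) at time t, augmented with the null events *)
Definition augmented_filtration (X0 : T -> R) (W : R -> T -> R) (t : R) :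
    set (set T) :=
  <<s preimages X0 `|` \bigcup_(s in `[0, t]) preimages (W s)
        `|` [set A | measurable A /\ P A = 0%E] >>.

(* X is a non-negative strong solution, with initial value X0, of
   dX = alpha (mu - X) dt + sigma sqrt(X) dW *)
Record cir_solution (alpha mu sigma : R) (W : R -> {RV P >-> R})
    (X0 : {RV P >-> R}) (X : R -> {RV P >-> R}) : Prop := CirSolution {
  cir_adapted : forall t : R, 0 <= t ->
    preimages (X t) `<=` augmented_filtration X0 W t ;
  cir_continuous : continuous_paths X ;
  cir_ge0 : {ae P, forall w, forall t : R, 0 <= t -> 0 <= X t w} ;
  cir_equation : exists I : R -> {RV P >-> R}, forall t : R, 0 <= t ->
    ito_integral W (fun s w => Num.sqrt (X s w)) t (I t) /\
    {ae P, forall w, X t w =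
      X0 w
      + \int[lebesgue_measure]_(s in `[0, t]) (alpha * (mu - X s w))
      + sigma * I t w} }.

(* [Num.sqrt] is 0 on negative arguments, which occur only on a null set when
   X0 >= 0 a.s., theta >= 1 and sigma ^ 2 <= 4 alpha mu. *)
Fixpoint theta_milstein (alpha mu sigma theta Delta : R) (W : R -> T -> R)
    (X0 : T -> R) (n : nat) (w : T) : R :=
  match n with
  | 0%N => X0 w
  | k.+1 =>
    let x := theta_milstein alpha mu sigma theta Delta W X0 k w in
    let dW := W (k.+1%:R * Delta) w - W (k%:R * Delta) w in
    (1 + alpha * theta * Delta)^-1 *
      ((1 - alpha * Delta + alpha * theta * Delta) * x
       + (alpha * mu - sigma ^+ 2 / 4) * Delta
       + sigma * Num.sqrt x * dW
       + sigma ^+ 2 / 4 * dW ^+ 2)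
  end.

Definition second_moment (Z : T -> R) : \bar R := 'E_P[fun w => Z w ^+ 2].

Definition preserves_second_moment (Y : nat -> T -> R) (X : R -> T -> R) :
    Prop :=
  exists l : R, (second_moment (Y n) @[n --> \oo] --> l%:E) /\
                (second_moment (X t) @[t --> +oo%R] --> l%:E).

End processes.

(* Main.v *)
From HB Require Import structures.
Require Import Defs.
From mathcomp Require Import all_boot all_order all_algebra.
From mathcomp Require Import all_classical all_reals all_analysis.
From mathcomp Require Import measurable_realfun ring lra.

Import Order.TTheory GRing.Theory Num.Theory.
Import numFieldNormedType.Exports.

Set Implicit Arguments.
Unset Strict Implicit.
Unset Printing Implicit Defensive.

Local Open Scope classical_set_scope.
Local Open Scope ring_scope.

(** Write x = alpha Delta, c = 1 + theta x, a = 1 - x + theta x and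
    k = sigma^2 / 4. One step of the scheme sends X_n to
      (a X_n + b + sigma sqrt(X_n) dW + k dW^2) / c,  b = (alpha mu - k) Delta,
    where the increment dW is N(0, Delta) and independent of X_n: the iterate
    is a function of X_0 and of the values of W up to time n Delta
    ([independent_past_increment]). For a nonnegative iterate the numerator is
      (a - 1) X_n + b + (sqrt(X_n) + sigma dW / 2)^2 >= 0,
    so nonnegativity propagates. Conditioning on X_n, that is, integrating
    dW out by Fubini, and using the Gaussian moments 0, Delta, 0, 3 Delta^2,
    the square root only survives as sigma^2 X_n. Hence the first two moments
    obey a closed affine recursion ([milstein_step_moments]):
      E X_{n+1}   = rho E X_n + (1 - rho) mu,          rho = a / c < 1,
      E X_{n+1}^2 = rho^2 E X_n^2 + B E X_n + C.
    It is triangular with eigenvalues rho and rho^2, so it always converges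
    ([cvg_moment_recursion]), and E X_n^2 tends to
    L = (B mu + C) / (1 - rho^2). Simplifying,
      L - (mu^2 + sigma^2 mu / (2 alpha))
        = K (sigma^2 - 4 alpha mu (2 theta - 1))   with K > 0
    ([cvg_second_moment_theta_milstein]). The scheme therefore preserves the
    long-term second moment exactly when sigma^2 = 4 alpha mu (2 theta - 1).
    For theta = 1 this is 4 alpha mu = sigma^2; and if theta >= 1 the right-hand
    side is at least 4 alpha mu, which excludes sigma^2 < 4 alpha mu.

    The Gaussian moments come from Stein's identity
      E [k D^(k-1)] = E [D^(k+1)] / s^2   for D ~ N(0, s^2),
    the integral over the line of the derivative of x^k times the density
    ([normal_stein]). *)

(** * Moments of the centred normal density *)

(** Over [-n, n] the integral is F(n) - F(-n), which vanishes in the limit;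
    integrability of f lets the integral follow by dominated convergence. *)
Lemma integral_derive_eq0 {R : realType} (F f : R -> R) :
  (forall x : R, is_derive x 1 F (f x)) -> continuous f ->
  (@lebesgue_measure R).-integrable setT (EFin \o f) ->
  F n%:R @[n --> \oo] --> 0 -> F (- n%:R) @[n --> \oo] --> 0 ->
  (\int[lebesgue_measure]_x (f x)%:E = 0)%E.
Proof.
move=> dF cf intf F0 F0'.
pose A n := `[- n.+1%:R, n.+1%:R]%classic : set R.
pose f_ n x := ((f \_ (A n)) x)%:E.
have mf : measurable_fun [set: R] (EFin \o f).
  by apply/measurable_EFinP; exact: continuous_measurable_fun.
have mf_ n : measurable_fun [set: R] (f_ n).
  apply/measurable_EFinP; apply/(@measurable_restrictT _ _ _ _ (A n) f) => //.
    exact: measurable_itv.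
  by apply: measurable_funTS; exact: continuous_measurable_fun.
have f_f x : f_ ^~ x @ \oo --> (EFin \o f) x.
  apply: cvg_near_cst; near=> n; rewrite /f_ patchE mem_set//.
  rewrite /A/= in_itv/= -ler_norml.
  by apply: (@le_trans _ _ n%:R); [near: n; exact: nbhs_infty_ger|rewrite ler_nat].
have f_le x n : (`|f_ n x| <= `|(EFin \o f) x|)%E.
  by rewrite /f_ patchE; case: ifP => //= _; rewrite normr0 lee_fin.
have [] := @dominated_convergence _ _ _ lebesgue_measure setT measurableT
  f_ (EFin \o f) (abse \o (EFin \o f)) mf_ mf.
- by apply: aeW => x _; exact: f_f.
- exact: integrable_abse.
- by apply: aeW => x n _; exact: f_le.
move=> _ _ cvgI.
have IE n : (\int[lebesgue_measure]_x f_ n x = (F n.+1%:R - F (- n.+1%:R))%:E)%E.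
  transitivity (\int[lebesgue_measure]_(x in A n) (f x)%:E)%E.
    by rewrite [RHS]integral_mkcond restrict_EFin.
  have cF x : {for x, continuous F}.
    by apply: differentiable_continuous; apply/derivable1_diffP; have [] := dF x.
  rewrite EFinB; apply: continuous_FTC2.
  - by rewrite (@lt_trans _ _ 0)// ?oppr_lt0.
  - exact: continuous_subspaceT.
  - split; [by move=> y _; have [] := dF y| |].
      by apply: cvg_at_right_filter; exact: cF.
    by apply: cvg_at_left_filter; exact: cF.
  - by move=> x _; rewrite derive1E; have [] := dF x.
rewrite (_ : (\int[lebesgue_measure]_x (f x)%:E)%E =
    limn (fun n => \int[lebesgue_measure]_x f_ n x)%E); last first.
  exact/esym/(cvg_lim _ cvgI).
apply/cvg_lim => //.
under eq_fun do rewrite IE.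
apply: cvg_EFin; first by near=> n.
have cv (G : nat -> R) : G n @[n --> \oo] --> 0 -> G n.+1 @[n --> \oo] --> 0.
  by move=> G0; rewrite (cvg_shiftS G).
rewrite -(subr0 0); apply: (@cvgB _ R^o).
  exact: (cv (fun n => F n%:R)).
exact: (cv (fun n => F (- n%:R))).
Unshelve. all: by end_near. Qed.

Section gaussian.
Context {R : realType} (s : R).
Hypothesis s_gt0 : 0 < s.
Local Notation g := (normal_pdf 0 s).
Local Notation mu := (@lebesgue_measure R).

Lemma normal_pdf0E x : g x = normal_peak s * expR (- (x ^+ 2 / (2 * s ^+ 2))).
Proof.
rewrite normal_pdfE ?gt_eqF// /normal_fun subr0; congr (_ * expR _).
by rewrite mulNr -mulr_natl.
Qed.

Lemma is_derive_moment k (x : R) :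
  is_derive x 1 (fun y => y ^+ k * g y)
    (k%:R * (x ^+ k.-1 * g x) - (x ^+ k.+1 * g x) / s ^+ 2).
Proof.
under eq_fun do rewrite normal_pdf0E.
rewrite normal_pdf0E.
have H (y : R) : is_derive y 1 (fun y => - (y ^+ 2 / (2 * s ^+ 2))) (- y / s ^+ 2).
  apply: is_derive_eq.
  rewrite !scaler0 add0r addrC -[_ *: (_ + _)]/(_ * (_ + _)) -[y%:A]/(y * 1) mulr1.
  by field; rewrite gt_eqF.
have dE : is_derive x 1 (fun y => expR (- (y ^+ 2 / (2 * s ^+ 2))))
    (expR (- (x ^+ 2 / (2 * s ^+ 2))) * (- x / s ^+ 2)).
  exact: (is_derive1_comp (is_derive_expR _) (H x)).
have dX : is_derive x 1 (fun y : R => y ^+ k) (k%:R * x ^+ k.-1).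
  rewrite (_ : (fun y : R => y ^+ k) = id ^+ k); last first.
    by apply/funext => y; rewrite exprfctE.
  by apply: is_derive_eq; rewrite -[_ *: _]/(_ * _) mulr1.
apply: is_derive_eq.
rewrite -![_ *: _]/(_ * _) (exprS x k).
by field; rewrite gt_eqF.
Qed.

Lemma exprn_le_expR (u : R) j : 0 <= u -> u ^+ j <= j`!%:R * expR u.
Proof.
move=> u0; case: j => [|j].
  by rewrite expr0 fact0 mul1r -expR0 ler_expR.
rewrite mulrC -ler_pdivrMr ?ltr0n ?fact_gt0//.
by apply: le_trans (expR_ge1Dxn j u0); rewrite lerDr.
Qed.

(** The density is the square of exp (- u), u = x^2 / (4 s^2), up to a constant.
    One factor absorbs x^(2j), by u^j <= j! exp u; the other one is, up to a
    constant, the normal density of standard deviation sqrt 2 * s. *)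
Lemma normal_moment_ub j : exists2 K, 0 <= K & forall x,
  x ^+ j.*2 * g x <= K * normal_pdf 0 (Num.sqrt 2 * s) x.
Proof.
set s' := Num.sqrt 2 * s.
have s'0 : 0 < s' by rewrite mulr_gt0// sqrtr_gt0.
have peak_gt0 (t : R) : 0 < t -> 0 < normal_peak t.
  by move=> t0; rewrite normal_peak_gt0// gt_eqF.
exists (normal_peak s * (j`!%:R * (4 * s ^+ 2) ^+ j) / normal_peak s').
  have c0 : 0 <= (4 * s ^+ 2) ^+ j by rewrite exprn_ge0// mulr_ge0// sqr_ge0.
  by rewrite !mulr_ge0// ?invr_ge0 ?normal_peak_ge0.
move=> x; rewrite normal_pdf0E (@normal_pdfE _ _ s') ?gt_eqF// /normal_fun subr0.
set u := x ^+ 2 / (4 * s ^+ 2).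
have -> : - x ^+ 2 / (s' ^+ 2 *+ 2) = - u.
  rewrite /u /s' exprMn sqr_sqrtr// -mulr_natr mulNr.
  by congr (- (_ / _)); ring.
have -> : - (x ^+ 2 / (2 * s ^+ 2)) = - u - u.
  by rewrite /u; field; rewrite gt_eqF.
have -> : x ^+ j.*2 = (4 * s ^+ 2) ^+ j * u ^+ j.
  rewrite -exprMn -mul2n exprM /u; congr (_ ^+ j); field.
  by rewrite gt_eqF.
rewrite expRD.
have u0 : 0 <= u by rewrite /u divr_ge0// ?sqr_ge0// mulr_ge0// sqr_ge0.
have H : u ^+ j * expR (- u) <= j`!%:R.
  by rewrite expRN ler_pdivrMr ?expR_gt0// exprn_le_expR.
have -> : normal_peak s * (j`!%:R * (4 * s ^+ 2) ^+ j) / normal_peak s' *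
    (normal_peak s' * expR (- u)) =
    normal_peak s * (4 * s ^+ 2) ^+ j * expR (- u) * j`!%:R.
  by field; rewrite gt_eqF ?peak_gt0.
rewrite [leLHS](_ : _ = normal_peak s * (4 * s ^+ 2) ^+ j * expR (- u) *
   (u ^+ j * expR (- u))); last by ring.
rewrite ler_wpM2l// !mulr_ge0 ?expR_ge0 ?normal_peak_ge0//.
by rewrite exprn_ge0// mulr_ge0// sqr_ge0.
Qed.

(** Odd powers reduce to even ones by y <= 1 + y^2 with y = |x|^k. The bound is
    both integrable and bounded, which serves the next two lemmas. *)
Lemma normal_moment_dominated k : exists2 K, 0 <= K & forall x,
  `|x ^+ k * g x| <= g x + K * normal_pdf 0 (Num.sqrt 2 * s) x.
Proof.
have [K K0 HK] := normal_moment_ub k.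
exists K => // x; apply: le_trans (lerD (lexx _) (HK x)).
have g0 := normal_pdf_ge0 0 s x.
rewrite normrM normrX (ger0_norm g0) -mul2n mulnC exprM.
rewrite -(@ger0_norm _ (x ^+ k ^+ 2)) ?sqr_ge0// !normrX.
rewrite -[X in X + _]mul1r -mulrDl ler_wpM2r//.
by have := sqr_ge0 (`|x| ^+ k - 2^-1); nra.
Qed.

Lemma integrable_normal_moment k :
  mu.-integrable setT (EFin \o (fun x => x ^+ k * g x)).
Proof.
have [K K0 HK] := normal_moment_dominated k.
have mg : measurable_fun [set: R] (fun x => x ^+ k * g x).
  apply: measurable_funM; last exact: measurable_normal_pdf.
  by apply: continuous_measurable_fun; exact: exprn_continuous.
apply: (@le_integrable _ _ _ mu setT measurableT _
  (fun x => (g x)%:E + K%:E * (normal_pdf 0 (Num.sqrt 2 * s) x)%:E)%E).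
- exact/measurable_EFinP.
- move=> x _; rewrite /= lee_fin.
  by apply: le_trans (HK x) _; exact: ler_norm.
- apply: integrableD => //; first exact: integrable_normal_pdf.
  by apply: integrableZl => //; exact: integrable_normal_pdf.
Qed.

(** The boundary terms of Stein's identity, at +oo for e = 1 and at -oo for
    e = -1: |x|^(k+1) times the density is bounded, so one power less decays like
    1 / |x|. *)
Lemma cvg_normal_moment k (e : R) : `|e| = 1 ->
  (e * n%:R) ^+ k * g (e * n%:R) @[n --> \oo] --> 0.
Proof.
move=> e1; have [K K0 HK] := normal_moment_dominated k.+1.
have s'0 : Num.sqrt 2 * s != 0 by rewrite gt_eqF// mulr_gt0// sqrtr_gt0.
set M := normal_peak s + K * normal_peak (Num.sqrt 2 * s).
have HM x : `|x| * `|x ^+ k * g x| <= M.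
  rewrite -normrM mulrA -exprS; apply: le_trans (HK x) _.
  by rewrite lerD ?ler_wpM2l ?normal_pdf_ub// gt_eqF.
rewrite -(cvg_shiftS (fun n => (e * n%:R) ^+ k * g (e * n%:R))).
apply/norm_cvg0P; apply: (@squeeze_cvgr _ _ _ _ (cst 0) (fun n => M * n.+1%:R^-1)).
- near=> n; rewrite /cst/= normr_ge0/= ler_pdivlMr ?ltr0n// mulrC.
  by have := HM (e * n.+1%:R); rewrite normrM e1 mul1r normr_nat.
- exact: cvg_cst.
- rewrite -[X in _ --> X](mulr0 M); apply: cvgM; first exact: cvg_cst.
  exact: cvg_harmonic.
Unshelve. all: by end_near. Qed.

(** Stein's identity: the integrand is the derivative of x^k times the density. *)
Lemma normal_stein k : (\int[mu]_x
  (k%:R * (x ^+ k.-1 * g x) - (x ^+ k.+1 * g x) / s ^+ 2)%:E = 0)%E.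
Proof.
have cm j : continuous (fun x : R => x ^+ j * g x : R).
  move=> x; apply: cvgM; first exact: exprn_continuous.
  by apply: continuous_normal_pdf; rewrite gt_eqF.
apply: (@integral_derive_eq0 _ _ _ (is_derive_moment k)).
- move=> x; apply: (@cvgB _ R^o); apply: cvgM; try exact: cvg_cst; exact: cm.
- rewrite (_ : EFin \o _ = (fun x => k%:R%:E * (x ^+ k.-1 * g x)%:E
      - (x ^+ k.+1 * g x)%:E * (s ^+ 2)^-1%:E)%E); last by apply/funext.
  apply: integrableB => //.
    by apply: integrableZl => //; exact: integrable_normal_moment.
  by apply: integrableZr => //; exact: integrable_normal_moment.
- under eq_fun do rewrite -[_%:R]mul1r.
  by apply: cvg_normal_moment; rewrite normr1.
- under eq_fun do rewrite -[- _]mulN1r.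
  by apply: cvg_normal_moment; rewrite normrN1.
Qed.

Local Notation M k := (\int[mu]_x (x ^+ k * g x)%:E)%E.

Lemma normal_moment_rec k : (M k.+2 = (s ^+ 2 * k.+1%:R)%:E * M k)%E.
Proof.
have im j := integrable_normal_moment j.
have s_neq0 : s != 0 by rewrite gt_eqF.
(* x^(k+2) g is a multiple of x^k g minus a multiple of Stein's integrand. *)
transitivity (\int[mu]_x ((s ^+ 2 * k.+1%:R)%:E * (x ^+ k * g x)%:E - (s ^+ 2)%:E *
    (k.+1%:R * (x ^+ k.+1.-1 * g x) - (x ^+ k.+2 * g x) / s ^+ 2)%:E))%E.
  apply: eq_integral => x _; rewrite -!EFinM -EFinB/=; congr EFin.
  by move: (x ^+ k.+2 * _ : R) (x ^+ k * _ : R) => a b; field.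
have iS : mu.-integrable setT (fun x =>
    (k.+1%:R * (x ^+ k.+1.-1 * g x) - (x ^+ k.+2 * g x) / s ^+ 2)%:E).
  rewrite (_ : (fun x => _) = (fun x => k.+1%:R%:E * (x ^+ k * g x)%:E
      - (x ^+ k.+2 * g x)%:E * (s ^+ 2)^-1%:E)%E); last by apply/funext.
  apply: integrableB => //.
    by apply: integrableZl => //; exact: im.
  by apply: integrableZr => //; exact: im.
rewrite integralB//=; first last.
- exact: integrableZl.
- by apply: integrableZl => //; exact: im.
rewrite integralZl//; last exact: im.
by rewrite integralZl// normal_stein mule0 sube0.
Qed.

Lemma normal_moment0 : M 0 = 1%E.
Proof.
rewrite -(integral_normal_pdf 0 s); apply: eq_integral => x _.
by rewrite expr0 mul1r.
Qed.

Lemma normal_moment1 : M 1 = 0%E.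
Proof.
have s_neq0 : s != 0 by rewrite gt_eqF.
transitivity (\int[mu]_x ((- s ^+ 2)%:E *
    (0%:R * (x ^+ 0.-1 * g x) - (x ^+ 1 * g x) / s ^+ 2)%:E))%E.
  apply: eq_integral => x _; rewrite -EFinM; congr EFin.
  by move: (x ^+ 1 * _ : R) => a; field.
rewrite integralZl//; first by rewrite (normal_stein 0) mule0.
rewrite (_ : (fun x => _) = (fun x => (x ^+ 1 * g x)%:E * (- (s ^+ 2)^-1)%:E)%E); last first.
  by apply/funext => x; rewrite mul0r sub0r -mulrN.
by apply: integrableZr => //; exact: integrable_normal_moment.
Qed.
End gaussian.

(** * Polynomial expectations of a normal variable *)

(** The Radon-Nikodym derivative of the normal law is almost everywhere its
    density, so this is change of variables along that derivative;
    integrability is transferred first, on the absolute value. *)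
Lemma integral_normal_prob {R : realType} (m s : R) (f : R -> R) :
  measurable_fun [set: R] f ->
  (@lebesgue_measure R).-integrable setT (fun x => (f x * normal_pdf m s x)%:E) ->
  (normal_prob m s).-integrable setT (EFin \o f) /\
  (\int[normal_prob m s]_x (f x)%:E =
   \int[lebesgue_measure]_x (f x * normal_pdf m s x)%:E)%E.
Proof.
set mu := @lebesgue_measure R; set N := normal_prob m s => mf intf.
have dom : N `<< mu := normal_prob_dominates m s.
have mpdf : measurable_fun [set: R] (fun x => (normal_pdf m s x)%:E).
  by apply/measurable_EFinP; exact: measurable_normal_pdf.
have mff : measurable_fun [set: R] (EFin \o f) by exact/measurable_EFinP.
have rnE : ae_eq mu setT (Radon_Nikodym_SigmaFinite.f N mu)
    (fun x => (normal_pdf m s x)%:E).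
  apply: integral_ae_eq => //.
  - exact: Radon_Nikodym_SigmaFinite.f_integrable.
  - by move=> E _ mE; rewrite -Radon_Nikodym_SigmaFinite.f_integral.
have mrn : measurable_fun [set: R] (Radon_Nikodym_SigmaFinite.f N mu).
  exact: measurable_int (Radon_Nikodym_SigmaFinite.f_integrable dom).
have fN : N.-integrable setT (EFin \o f).
  apply/integrableP; split=> //.
  rewrite -(Radon_Nikodym_SigmaFinite.change_of_variables dom)//; last first.
    exact: measurableT_comp.
  move/integrableP : intf => [_]; apply: le_lt_trans.
  rewrite le_eqVlt; apply/orP; left; apply/eqP.
  apply: ae_eq_integral => //.
  - by apply: emeasurable_funM => //; exact: measurableT_comp.
  - apply: measurableT_comp => //; apply/measurable_EFinP.
    by apply: measurable_funM => //; exact: measurable_normal_pdf.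
  - rewrite [X in ae_eq _ _ _ X](_ : _ =
      (fun x => `|(f x)%:E| * (normal_pdf m s x)%:E)%E).
      exact: ae_eqe_mul2l.
    apply/funext => x /=.
    by rewrite normrM (ger0_norm (normal_pdf_ge0 _ _ _)).
split => //.
rewrite -(Radon_Nikodym_change_of_variables dom)//.
apply: ae_eq_integral => //.
- by apply: emeasurable_funM.
- by apply/measurable_EFinP/measurable_funM => //; exact: measurable_normal_pdf.
- rewrite [X in ae_eq _ _ _ X](_ : _ =
    (fun x => (f x)%:E * (normal_pdf m s x)%:E)%E); last exact/funext.
  apply: ae_eqe_mul2l; apply: ae_eq_trans rnE; apply: ae_eq_sym.
  exact: ae_eq_Radon_Nikodym_SigmaFinite.
Qed.

Section normal_variable.
Context {d : measure_display} {T : measurableType d} {R : realType}.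
Variables (P : probability T R) (D : {RV P >-> R}) (s : R).
Hypothesis s_gt0 : 0 < s.
Hypothesis law : forall B, measurable B -> P (D @^-1` B) = normal_prob 0 s B.

Lemma normal_variable_moment k :
  P.-integrable setT (EFin \o (fun w => D w ^+ k)) /\
  (\int[P]_w (D w ^+ k)%:E =
   \int[lebesgue_measure]_x (x ^+ k * normal_pdf 0 s x)%:E)%E.
Proof.
have mX : measurable_fun [set: R] (fun x : R => x ^+ k).
  by apply: continuous_measurable_fun; exact: exprn_continuous.
have [iN <-] := integral_normal_prob mX (integrable_normal_moment s_gt0 k).
(* The normal law lives on the Borel sets presented as a generated
   sigma-algebra, so D is retyped to let its law be compared with it. *)
pose D_ : T -> measurableTypeR R := D.
have mD_ : measurable_fun setT D_ by move=> _ B mB; apply: (@measurable_funP _ _ _ _ setT D).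
pose D' : {mfun T >-> measurableTypeR R} :=
  HB.pack D_ (isMeasurableFun.Build _ _ _ _ _ mD_).
have lawE (f : measurableTypeR R -> \bar R) :
    (\int[normal_prob 0 s]_x f x = \int[distribution P D']_x f x)%E.
  by apply: eq_measure_integral => A mA _; exact/esym/law.
have iP : P.-integrable setT (EFin \o (fun w => D w ^+ k)).
  apply/integrableP; split.
    by apply/measurable_EFinP; exact: (measurableT_comp mX).
  move/integrableP : iN => [_]; rewrite lawE.
  by rewrite ge0_integral_distribution//; exact/measurable_EFinP/measurableT_comp.
split => //.
rewrite lawE integral_distribution//.
exact/measurable_EFinP.
Qed.

Lemma normal_variable_poly4 (a0 a1 a2 a3 a4 : R) :
  (\int[P]_w (a0 + a1 * D w + a2 * D w ^+ 2 + a3 * D w ^+ 3 + a4 * D w ^+ 4)%:E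
   = (a0 + a2 * s ^+ 2 + a4 * (3 * s ^+ 4))%:E)%E.
Proof.
have M0 := normal_moment0 s.
have M1 := normal_moment1 s_gt0.
have M2 := normal_moment_rec s_gt0 0.
have M3 := normal_moment_rec s_gt0 1.
have M4 := normal_moment_rec s_gt0 2.
rewrite M0 in M2; rewrite M1 in M3; rewrite M2 in M4.
pose I (f : T -> \bar R) (x : \bar R) :=
  P.-integrable setT f /\ (\int[P]_w f w = x)%E.
have ID f x g y : I f x -> I g y -> I (fun w => f w + g w)%E (x + y)%E.
  by move=> [fi fx] [gi gy]; split; [exact: integrableD|rewrite integralD// fx gy].
have IZ k a : I (fun w => (a * D w ^+ k)%:E)
    (a%:E * \int[lebesgue_measure]_x (x ^+ k * normal_pdf 0 s x)%:E)%E.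
  have [ik Ek] := normal_variable_moment k; rewrite -Ek.
  under eq_fun do rewrite EFinM.
  by split; [exact: integrableZl|rewrite integralZl].
have [_ E] := ID _ _ _ _ (ID _ _ _ _ (ID _ _ _ _ (ID _ _ _ _
  (IZ 0 a0) (IZ 1 a1)) (IZ 2 a2)) (IZ 3 a3)) (IZ 4 a4).
rewrite M0 M1 M2 M3 M4 in E.
transitivity (\int[P]_w ((a0 * D w ^+ 0)%:E + (a1 * D w ^+ 1)%:E +
    (a2 * D w ^+ 2)%:E + (a3 * D w ^+ 3)%:E + (a4 * D w ^+ 4)%:E))%E.
  by apply: eq_integral => w _; rewrite expr0 expr1 mulr1 !EFinD.
rewrite E !mule0 !adde0 !mule1 -!EFinM -!EFinD; congr EFin.
ring.
Qed.
End normal_variable.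

(** * Independence *)

Section independence.
Context {d : measure_display} {T : measurableType d} {R : realType}.
Variables (P : probability T R).
Local Open Scope ereal_scope.

(** Independence makes the law of (Y, D) the product of the laws, since both
    agree on rectangles; the double integral is then Tonelli's theorem. *)
Lemma independent_fubini (Y D : {RV P >-> R}) (h : R * R -> \bar R) :
  independent P (preimages Y) (preimages D) ->
  measurable_fun [set: R * R] h -> (forall z, 0 <= h z) ->
  \int[P]_w h (Y w, D w) = \int[P]_w \int[P]_v h (Y w, D v).
Proof.
move=> ind mh h0.
have mYD : measurable_fun [set: T] (fun w => (Y w, D w)).
  by apply/measurable_fun_pairP; split; exact: measurable_funP.
pose YD : {mfun T >-> (R * R)%type} :=
  HB.pack (fun w => (Y w, D w)) (isMeasurableFun.Build _ _ _ _ _ mYD).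
transitivity (\int[distribution P Y \x distribution P D]_z h z).
  transitivity (\int[distribution P YD]_z h z).
    by rewrite ge0_integral_distribution.
  apply: eq_measure_integral => A mA _.
  apply/esym; apply: product_measure_unique => // B C mB mC.
  rewrite /distribution /pushforward/= -ind.
  - by congr (P _); apply/seteqP; split.
  - by exists B => //; rewrite setTI.
  - by exists C => //; rewrite setTI.
rewrite fubini_tonelli1// ge0_integral_distribution//; last first.
- by move=> y; exact: integral_ge0.
- exact: measurable_fun_fubini_tonelli_F.
apply: eq_integral => w _ /=.
rewrite /fubini_F ge0_integral_distribution//.
exact: measurableT_comp.
Qed.

(** Pi-lambda argument: for fixed B, the events A independent of B form a
    lambda-system. *)
Lemma independent_g_sigma (C F : set (set T)) :
  setI_closed C -> C `<=` measurable -> F `<=` measurable ->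
  independent P C F -> independent P <<s C >> F.
Proof.
move=> IC mC mF ind A B CA FB; move: A CA.
pose L := [set A | measurable A /\ P (A `&` B) = P A * P B].
have mB : measurable B := mF _ FB.
suff : <<s C >> `<=` L by move=> H A /H[].
apply: lambda_system_subset => //; last first.
- by move=> A CA; split; [exact: mC|exact: ind].
- apply/dynkin_lambda_system; split.
  + by split => //; rewrite setTI probability_setT mul1e.
  + move=> A [mA PAB]; split; first exact: measurableC.
    rewrite setIC -setDE measureD//; last first.
      by rewrite -ge0_fin_numE// fin_num_measure.
    transitivity (P B - P A * P B); first by congr (_ - _); rewrite setIC.
    rewrite probability_setC// muleBl ?mul1e//.
    by rewrite fin_num_measure.
  + move=> A tA LA; have mA n : measurable (A n) by have [] := LA n.
    split; first exact: bigcup_measurable.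
    rewrite setI_bigcupl measure_bigcup//; last 2 first.
      by move=> n _; exact: measurableI.
      exact: trivIset_setIr.
    rewrite measure_bigcup// muleC -(fineK (fin_num_measure P B mB)).
    rewrite -nneseriesZl//; apply: eq_eseriesr => n _.
    by rewrite fineK ?fin_num_measure// muleC; exact: (LA n).2.
Qed.
End independence.

(** * The past of the driving process *)

Section adapted.
Context {d : measure_display} {T : measurableType d} {R : realType}.
Implicit Types (G : set (set T)) (Z : T -> R).

(** Turns inclusions between generated sigma-algebras into measurability, which
    is stable under the arithmetic operations of the scheme. *)
Lemma g_sigma_measurable_fun G Z :
  measurable_fun (setT : set (g_sigma_algebraType G)) Z <->
  preimages Z `<=` <<s G >>.
Proof.
split=> [mZ _ [B mB <-]|GZ _ B mB].
  exact: (mZ measurableT B mB).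
by apply: GZ; exists B.
Qed.

Lemma preimages_measurable Z : measurable_fun setT Z ->
  preimages Z `<=` measurable.
Proof. by move=> mZ _ [B mB <-]; exact: mZ. Qed.

End adapted.

Section past.
Context {d : measure_display} {T : measurableType d} {R : realType}.
Variables (P : probability T R) (W : R -> {RV P >-> R}) (X0 : {RV P >-> R}).
Hypothesis W_wiener : wiener_process W.
Hypothesis X0_indep : independent P (preimages X0) (sigma_of `[0, +oo[ W).

(** Generators of the information available at time s. *)
Definition past (s : R) : set (set T) :=
  preimages X0 `|` \bigcup_(u in `[0, s]) preimages (W u).

Lemma measurable_past_X0 s :
  measurable_fun (setT : set (g_sigma_algebraType (past s))) X0.
Proof.
apply/g_sigma_measurable_fun => A XA; apply: sub_sigma_algebra; by left.
Qed.

Lemma measurable_past_W s u : 0 <= u -> u <= s ->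
  measurable_fun (setT : set (g_sigma_algebraType (past s))) (W u).
Proof.
move=> u0 us; apply/g_sigma_measurable_fun => A XA; apply: sub_sigma_algebra.
by right; exists u => //=; rewrite in_itv/= u0.
Qed.

(** The hypotheses give independence of the increment from W on [0, s], and of
    X0 from all of W. For A in sigma(X0), B in sigma(W on [0, s]) and E an event
    of the increment they combine to
      P (A B E) = P A * P (B E) = P A * P B * P E = P (A B) * P E,
    and the events A B are a pi-system generating the past. *)
Lemma independent_past_increment s t : 0 <= s -> s < t ->
  independent P <<s past s >> (preimages (W t \- W s)).
Proof.
move=> s0 st.
have sub_itv (D : set R) (u : R) : D u -> preimages (W u) `<=` sigma_of D W.
  by move=> Du A WA; apply: sub_sigma_algebra; exists u.
have sW : sigma_of `[0, s] W `<=` sigma_of `[0, +oo[ W.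
  apply: smallest_sub; first exact: smallest_sigma_algebra.
  move=> A [u]; rewrite /= in_itv/= => /andP[u0 _]; apply: sub_itv.
  by rewrite /= in_itv/= u0.
have mW D : sigma_of D W `<=` measurable.
  apply: smallest_sub; first exact: sigma_algebra_measurable.
  move=> A [u _]; apply: preimages_measurable; exact: measurable_funP.
have incrW : preimages (W t \- W s) `<=` sigma_of `[0, +oo[ W.
  apply/g_sigma_measurable_fun; apply: measurable_funB;
    apply/g_sigma_measurable_fun; apply: sub_itv; rewrite /= in_itv/= ?s0//.
  by rewrite (le_trans s0 (ltW st)).
have mX0 : preimages X0 `<=` measurable.
  by apply: preimages_measurable; exact: measurable_funP.
pose C := [set E | exists A B, [/\ preimages X0 A, sigma_of `[0, s] W B & E = A `&` B]].
have indC : independent P C (preimages (W t \- W s)).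
  move=> _ E [A [B [XA WB ->]]] WE.
  have WBE : sigma_of `[0, +oo[ W (B `&` E).
    apply: (@measurableI _ (g_sigma_algebraType (\bigcup_(u in `[0, +oo[) preimages (W u)))).
      exact: sW.
    exact: incrW.
  rewrite -setIA X0_indep// (wiener_indep_increments W_wiener s0 st)//.
  by rewrite muleA X0_indep//; exact: sW.
have H : independent P <<s C >> (preimages (W t \- W s)).
  apply: independent_g_sigma indC.
  - move=> _ _ [A1 [B1 [XA1 WB1 ->]]] [A2 [B2 [XA2 WB2 ->]]].
    exists (A1 `&` A2), (B1 `&` B2); split; last by rewrite setIACA.
      case: XA1 XA2 => [U1 mU1 <-] [U2 mU2 <-].
      by exists (U1 `&` U2); [exact: measurableI|rewrite !setTI preimage_setI].
    exact: (@measurableI _ (g_sigma_algebraType (\bigcup_(u in `[0, s]) preimages (W u)))).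
  - by move=> _ [A [B [XA WB ->]]]; apply: measurableI; [exact: mX0|exact: mW WB].
  - by move=> A /incrW /mW.
have sC : <<s past s >> `<=` <<s C >>.
  apply: smallest_sub; first exact: smallest_sigma_algebra.
  move=> A [XA|[u us WA]]; apply: sub_sigma_algebra.
    exists A, setT; split => //; last by rewrite setIT.
    exact: (@measurableT _ (g_sigma_algebraType (\bigcup_(u in `[0, s]) preimages (W u)))).
  exists setT, A; split => //; last by rewrite setTI.
  - by exists setT => //; rewrite setTI preimage_setT.
  - by apply: sub_sigma_algebra; exists u.
by move=> A B /sC; exact: H.
Qed.
End past.

(** * One step of the scheme *)

Definition milstein_step {R : realType} (a b c sigma x y : R) : R :=
  c^-1 * (a * x + b + sigma * Num.sqrt x * y + sigma ^+ 2 / 4 * y ^+ 2).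

Lemma measurable_milstein_step {d} {T : measurableType d} {R : realType}
    (a b c sigma : R) (f g : T -> R) :
  measurable_fun setT f -> measurable_fun setT g ->
  measurable_fun setT (fun w => milstein_step a b c sigma (f w) (g w)).
Proof.
move=> mf mg; apply: measurable_funM => //; apply: measurable_funD.
  apply: measurable_funD.
    by apply: measurable_funD => //; exact: measurable_funM.
  apply: measurable_funM => //; apply: measurable_funM => //.
  apply: measurableT_comp mf.
  by apply: continuous_measurable_fun; exact: sqrt_continuous.
by apply: measurable_funM => //; exact: measurable_funX.
Qed.

Section moments.
Context {d : measure_display} {T : measurableType d} {R : realType}.
Variables (P : probability T R).
Local Open Scope ereal_scope.

Lemma integrable_of_sqr (Z : T -> R) : measurable_fun setT Z ->
  P.-integrable setT (fun w => (Z w ^+ 2)%:E) -> P.-integrable setT (EFin \o Z).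
Proof.
move=> mZ iZ.
apply: (@le_integrable _ _ _ P setT measurableT _ (fun w => 1%:E + (Z w ^+ 2)%:E)).
- exact/measurable_EFinP.
- move=> w _; rewrite /= lee_fin [leRHS]ger0_norm ?addr_ge0 ?sqr_ge0//.
  by rewrite -real_normK ?num_real//; have := sqr_ge0 (`|Z w| - 1)%R; nra.
- apply: integrableD => //; exact: finite_measure_integrable_cst.
Qed.

Lemma integral_affine2 (Z : T -> R) (a b c m1 m2 : R) :
  P.-integrable setT (EFin \o Z) -> P.-integrable setT (fun w => (Z w ^+ 2)%:E) ->
  \int[P]_w (Z w)%:E = m1%:E -> \int[P]_w (Z w ^+ 2)%:E = m2%:E ->
  \int[P]_w (a * Z w ^+ 2 + b * Z w + c)%:E = (a * m2 + b * m1 + c)%:E.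
Proof.
move=> i1 i2 E1 E2.
under eq_integral do rewrite 2!EFinD 2!EFinM.
rewrite integralD//=; last 2 first.
- apply: integrableD => //.
    exact: (integrableZl measurableT a i2).
  exact: (integrableZl measurableT b i1).
- exact: finite_measure_integrable_cst.
rewrite integralD//=; last 2 first.
- by apply: (integrableZl measurableT a i2).
- by apply: (integrableZl measurableT b i1).
rewrite (integralZl measurableT i2) (integralZl measurableT i1)/=.
rewrite E2 E1 integral_cst//= probability_setT mule1.
by rewrite -!EFinM -!EFinD.
Qed.

(** The inner integral over D of the step, or of its square, at a fixed Y = x is
    a polynomial of degree at most 2 in x when x >= 0, because the square root
    only enters through its even powers. Averaging it over Y then uses only the
    first two moments of Y. *)
Lemma milstein_step_moments (Y D : {RV P >-> R}) (a b c sigma s m1 m2 : R) :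
  (0 < s)%R -> (0 < c)%R -> (1 <= a)%R -> (0 <= b)%R ->
  (forall B, measurable B -> P (D @^-1` B) = normal_prob 0 s B) ->
  independent P (preimages Y) (preimages D) ->
  {ae P, forall w, (0 <= Y w)%R} ->
  P.-integrable setT (fun w => (Y w ^+ 2)%:E) ->
  \int[P]_w (Y w)%:E = m1%:E -> \int[P]_w (Y w ^+ 2)%:E = m2%:E ->
  let Z w := milstein_step a b c sigma (Y w) (D w) in
  let k := (sigma ^+ 2 / 4)%R in
  [/\ {ae P, forall w, (0 <= Z w)%R},
     P.-integrable setT (fun w => (Z w ^+ 2)%:E),
     \int[P]_w (Z w)%:E = (c^-1 * (a * m1 + b + k * s ^+ 2))%:E &
     \int[P]_w (Z w ^+ 2)%:E = (c^-1 ^+ 2 * (a ^+ 2 * m2 +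
       (2 * a * b + 4 * k * s ^+ 2 + 2 * a * k * s ^+ 2) * m1 +
       (b ^+ 2 + 2 * b * k * s ^+ 2 + 3 * k ^+ 2 * s ^+ 4)))%:E].
Proof.
move=> s0 c0 a1 b0 law ind Y0 iY2 E1 E2 Z k.
have mY : measurable_fun [set: T] Y by exact: measurable_funP.
have mD : measurable_fun [set: T] D by exact: measurable_funP.
have iY := integrable_of_sqr mY iY2.
pose F z : R := milstein_step a b c sigma z.1 z.2.
have F_ge0 x y : (0 <= x -> 0 <= F (x, y))%R.
  move=> x0.
  have -> : F (x, y) = (c^-1 * ((a - 1) * x + b + (Num.sqrt x + sigma / 2 * y) ^+ 2))%R.
    rewrite /F /milstein_step/=; congr (_ * _)%R.
    by rewrite sqrrD sqr_sqrtr//; field.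
  rewrite mulr_ge0 ?invr_ge0 ?(ltW c0)//.
  by rewrite !addr_ge0// ?sqr_ge0// mulr_ge0// subr_ge0.
have mF : measurable_fun [set: R * R] F by exact: measurable_milstein_step.
have mZ : measurable_fun [set: T] Z by exact: measurable_milstein_step.
(* Tonelli needs a nonnegative integrand for all x and y, whereas the step is
   nonnegative for x >= 0 only: below G is its square or its absolute value. *)
have FP (G : R -> R -> R) (p q r : R) :
   measurable_fun [set: R * R] (fun z => G z.1 z.2) ->
   (forall x y, 0 <= G x y)%R ->
   (forall x, (0 <= x)%R -> \int[P]_v (G x (D v))%:E = (p * x ^+ 2 + q * x + r)%:E) ->
   \int[P]_w (G (Y w) (D w))%:E = (p * m2 + q * m1 + r)%:E.
  move=> mG G0 GI.
  rewrite (@independent_fubini _ _ _ _ Y D (fun z => (G z.1 z.2)%:E))//=; last 2 first.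
  - exact/measurable_EFinP.
  - by move=> z; rewrite lee_fin.
  rewrite -(@integral_affine2 Y)//.
  apply: ae_eq_integral => //.
  - have mGD : measurable_fun [set: R * T] (fun z => (G z.1 (D z.2))%:E).
      apply/measurable_EFinP.
      have mp : measurable_fun [set: R * T] (fun z => (z.1, D z.2)).
        apply/measurable_fun_pairP; split; first exact: measurable_fst.
        exact: (measurableT_comp mD measurable_snd).
      exact: (measurableT_comp mG mp).
    have := measurable_fun_fubini_tonelli_F (m2 := P) _ mGD.
    move=> /(_ _) H; apply: (measurableT_comp (H _) mY).
    by move=> z; rewrite lee_fin.
  - apply/measurable_EFinP; apply: measurable_funD => //.
    by apply: measurable_funD; apply: measurable_funM => //; exact: measurable_funX.
  - apply: filterS Y0 => w Yw0 _; exact: GI.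
have ae_Z : {ae P, forall w, (0 <= Z w)%R}.
  by apply: filterS Y0 => w Yw; exact: (F_ge0 _ (D w) Yw).
have EZ2 : \int[P]_w (Z w ^+ 2)%:E = (c^-1 ^+ 2 * (a ^+ 2 * m2 +
       (2 * a * b + 4 * k * s ^+ 2 + 2 * a * k * s ^+ 2) * m1 +
       (b ^+ 2 + 2 * b * k * s ^+ 2 + 3 * k ^+ 2 * s ^+ 4)))%:E.
  pose q := (c^-1 ^+ 2)%R.
  transitivity ((q * a ^+ 2) * m2 +
      (q * (2 * a * b + 4 * k * s ^+ 2 + 2 * a * k * s ^+ 2)) * m1 +
      q * (b ^+ 2 + 2 * b * k * s ^+ 2 + 3 * k ^+ 2 * s ^+ 4))%:E; last first.
    by congr EFin; rewrite -/q; ring.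
  apply: (FP (fun x y => F (x, y) ^+ 2)%R).
  - by apply: measurable_funX; under eq_fun do rewrite -surjective_pairing.
  - by move=> x y; exact: sqr_ge0.
  - move=> x x0.
    (* The step is (A + B y + k y^2) / c, and B^2 is affine in x. *)
    pose A := (a * x + b)%R; pose B := (sigma * Num.sqrt x)%R.
    have BE : (B ^+ 2 = 4 * k * x)%R.
      by rewrite exprMn sqr_sqrtr// /k; field.
    transitivity (\int[P]_v (q * A ^+ 2 + q * (2 * A * B) * D v
      + q * (B ^+ 2 + 2 * A * k) * D v ^+ 2
      + q * (2 * B * k) * D v ^+ 3 + q * k ^+ 2 * D v ^+ 4)%:E).
      apply: eq_integral => v _; congr EFin.
      rewrite /F /milstein_step/= -/k -/A -/B /q; ring.
    rewrite (normal_variable_poly4 s0 law) BE; congr EFin.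
    rewrite /A; ring.
have iZ2 : P.-integrable setT (fun w => (Z w ^+ 2)%:E).
  apply/integrableP; split; first by apply/measurable_EFinP; exact: measurable_funX.
  under eq_integral do rewrite /= ger0_norm ?sqr_ge0//.
  by rewrite EZ2 ltry.
split => //.
transitivity (\int[P]_w `|Z w|%:E).
  apply: ae_eq_integral => //.
  - exact/measurable_EFinP.
  - by apply/measurable_EFinP; exact: measurableT_comp.
  - by apply: filterS ae_Z => w Zw _; rewrite ger0_norm.
rewrite (FP (fun x y => `|F (x, y)|)%R 0%R (c^-1 * a)%R (c^-1 * (b + k * s ^+ 2))%R)//.
- by rewrite mul0r add0r; congr EFin; ring.
- by apply: measurableT_comp => //; under eq_fun do rewrite -surjective_pairing.
- move=> x x0.
  pose A := (a * x + b)%R; pose B := (sigma * Num.sqrt x)%R.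
  transitivity (\int[P]_v (c^-1 * A + c^-1 * B * D v
      + c^-1 * k * D v ^+ 2 + 0 * D v ^+ 3 + 0 * D v ^+ 4)%:E).
    apply: eq_integral => v _; congr EFin.
    rewrite ger0_norm ?F_ge0//.
    rewrite /F /milstein_step/= -/k -/A -/B; ring.
  rewrite (normal_variable_poly4 s0 law); congr EFin.
  rewrite /A; ring.
Qed.
End moments.

(** * The moment recursion and its limit *)

(** The recursion is triangular with distinct eigenvalues rho and rho ^+ 2, so
    subtracting beta * u from v, with beta = B / (rho - rho ^+ 2), decouples it
    and both sequences have an explicit geometric form. *)
Lemma cvg_moment_recursion {R : realType} (rho mu B C : R) (u v : nat -> R) :
  0 < rho < 1 ->
  (forall n, u n.+1 = rho * u n + (1 - rho) * mu) ->
  (forall n, v n.+1 = rho ^+ 2 * v n + B * u n + C) ->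
  v n @[n --> \oo] --> (B * mu + C) / (1 - rho ^+ 2).
Proof.
move=> /andP[rho0 rho1] uE vE; set L := _ / _.
pose beta := B / (rho - rho ^+ 2).
have rn0 : rho != 0 by rewrite gt_eqF.
have r1 : 1 - rho != 0 by rewrite subr_eq0 gt_eqF.
have r2 : 1 - rho ^+ 2 != 0.
  by rewrite subr_eq0 gt_eqF// expr_lt1 ?ltW.
have un n : u n = mu + rho ^+ n * (u 0%N - mu).
  elim: n => [|n IH]; first by rewrite expr0; ring.
  by rewrite uE IH exprS; ring.
have vn n : v n = L + rho ^+ n * (beta * (u 0%N - mu)) +
    (rho ^+ 2) ^+ n * (v 0%N - L - beta * (u 0%N - mu)).
  elim: n => [|n IH]; first by rewrite !expr0; ring.
  have CE : C = (1 - rho ^+ 2) * L - B * mu by rewrite /L; field.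
  have BE : B = beta * (rho - rho ^+ 2).
    rewrite /beta; field.
    by rewrite (_ : rho - rho ^+ 2 = rho * (1 - rho)) ?mulf_neq0//; ring.
  rewrite vE IH (un n) (exprS rho n) (exprS (rho ^+ 2) n) CE BE.
  by ring.
have r2lt : `|rho ^+ 2| < 1.
  by rewrite ger0_norm ?sqr_ge0// expr_lt1 ?ltW.
have r1lt : `|rho| < 1 by rewrite ger0_norm ?ltW.
pose A := beta * (u 0%N - mu); pose E := v 0%N - L - A.
have vE' : v = (fun n => L + rho ^+ n * A + (rho ^+ 2) ^+ n * E).
  by apply/funext => n; rewrite vn.
have : (L + rho ^+ n * A + (rho ^+ 2) ^+ n * E) @[n --> \oo] -->
    L + 0 * A + 0 * E.
  apply: (@cvgD _ R^o).
    apply: (@cvgD _ R^o); first exact: cvg_cst.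
    by apply: cvgM; [exact: cvg_expr|exact: cvg_cst].
  by apply: cvgM; [exact: cvg_expr|exact: cvg_cst].
by rewrite !mul0r !addr0 -vE'.
Qed.

Section scheme.
Context {d : measure_display} {T : measurableType d} {R : realType}.
Variables (P : probability T R) (alpha mu sigma Delta theta : R).
Hypotheses (alpha_gt0 : 0 < alpha) (sigma_gt0 : 0 < sigma).
Hypotheses (alpha_mu_sigma : sigma ^+ 2 <= 4 * alpha * mu).
Hypotheses (Delta_gt0 : 0 < Delta) (theta_ge1 : 1 <= theta).
Variables (W : R -> {RV P >-> R}) (X0 : {RV P >-> R}).
Hypotheses (W_wiener : wiener_process W) (X0_ge0 : {ae P, forall w, 0 <= X0 w}).
Hypothesis X0_indep : independent P (preimages X0) (sigma_of `[0, +oo[ W).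
Hypothesis X0_L2 : (second_moment P X0 < +oo)%E.

Local Notation Xn := (theta_milstein alpha mu sigma theta Delta W X0).
Local Notation c := (1 + alpha * theta * Delta).
Local Notation a := (1 - alpha * Delta + alpha * theta * Delta).
Local Notation b := ((alpha * mu - sigma ^+ 2 / 4) * Delta).
Local Notation k := (sigma ^+ 2 / 4).

Lemma measurable_past_theta_milstein n s : n%:R * Delta <= s ->
  measurable_fun (setT : set (g_sigma_algebraType (past W X0 s))) (Xn n).
Proof.
elim: n => [|n IH] ns; first exact: measurable_past_X0.
have nn : n%:R * Delta <= n.+1%:R * Delta by rewrite ler_pM2r// ler_nat.
have ns' := le_trans nn ns.
apply: measurable_milstein_step; first exact: IH.
by apply: measurable_funB; apply: measurable_past_W => //;
  rewrite mulr_ge0 ?ler0n ?(ltW Delta_gt0).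
Qed.

Lemma independent_theta_milstein_increment n :
  independent P (preimages (Xn n))
    (preimages (W (n.+1%:R * Delta) \- W (n%:R * Delta))).
Proof.
have st : n%:R * Delta < n.+1%:R * Delta by rewrite ltr_pM2r// ltr_nat.
have s0 : 0 <= n%:R * Delta by rewrite mulr_ge0 ?ler0n ?(ltW Delta_gt0).
move=> A B XA; apply: (independent_past_increment W_wiener X0_indep s0 st).
have /g_sigma_measurable_fun := measurable_past_theta_milstein (lexx (n%:R * Delta)).
exact.
Qed.

Lemma measurable_theta_milstein n : measurable_fun [set: T] (Xn n).
Proof.
elim: n => [|n IH]; first exact: measurable_funP.
by apply: measurable_milstein_step => //; apply: measurable_funB; exact: measurable_funP.
Qed.

(** The pair (E X_n, E X_n ^+ 2) started from m. *)
Fixpoint scheme_moments (m : R * R) (n : nat) : R * R :=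
  if n is n'.+1 then
    let m' := scheme_moments m n' in
    (c^-1 * (a * m'.1 + b + k * Delta),
     c^-1 ^+ 2 * (a ^+ 2 * m'.2 +
       (2 * a * b + 4 * k * Delta + 2 * a * k * Delta) * m'.1 +
       (b ^+ 2 + 2 * b * k * Delta + 3 * k ^+ 2 * Delta ^+ 2)))
  else m.

Lemma theta_milstein_moments : exists m, forall n,
  [/\ {ae P, forall w, 0 <= Xn n w},
     P.-integrable setT (fun w => (Xn n w ^+ 2)%:E),
     (\int[P]_w (Xn n w)%:E = (scheme_moments m n).1%:E)%E &
     (\int[P]_w (Xn n w ^+ 2)%:E = (scheme_moments m n).2%:E)%E].
Proof.
have iX2 : P.-integrable setT (fun w => (X0 w ^+ 2)%:E).
  apply/integrableP; split; first by apply/measurable_EFinP; exact: measurable_funX.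
  under eq_integral do rewrite /= ger0_norm ?sqr_ge0//.
  by move: X0_L2; rewrite /second_moment unlock.
have iX := integrable_of_sqr (measurable_funP X0) iX2.
exists (fine (\int[P]_w (X0 w)%:E)%E, fine (\int[P]_w (X0 w ^+ 2)%:E)%E).
elim=> [|n [Xn0 iXn E1 E2]].
  by split => //=; rewrite fineK//; exact: integrable_fin_num.
pose Y : {RV P >-> R} := HB.pack (Xn n)
  (isMeasurableFun.Build _ _ _ _ _ (measurable_theta_milstein n)).
pose dW := W (n.+1%:R * Delta) \- W (n%:R * Delta).
have mdW : measurable_fun [set: T] dW.
  by apply: measurable_funB; exact: measurable_funP.
pose D : {RV P >-> R} :=
  HB.pack dW (isMeasurableFun.Build _ _ _ _ _ mdW).
have st : n%:R * Delta < n.+1%:R * Delta by rewrite ltr_pM2r// ltr_nat.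
have s0 : 0 <= n%:R * Delta by rewrite mulr_ge0 ?ler0n ?(ltW Delta_gt0).
have law B : measurable B -> P (D @^-1` B) = normal_prob 0 (Num.sqrt Delta) B.
  move=> mB; have := wiener_normal_increments W_wiener s0 st mB.
  suff -> : n.+1%:R * Delta - n%:R * Delta = Delta by [].
  by rewrite -natr1; ring.
have sD : Num.sqrt Delta ^+ 2 = Delta by rewrite sqr_sqrtr// ltW.
have sD4 : Num.sqrt Delta ^+ 4 = Delta ^+ 2 by rewrite -[4%N]/(2 * 2)%N exprM sD.
have aD : 0 < alpha * Delta by rewrite mulr_gt0.
have aDt : alpha * Delta <= alpha * theta * Delta by rewrite mulrAC ler_peMr// ltW.
have := @milstein_step_moments _ _ _ P Y D a b c sigma (Num.sqrt Delta)
  (scheme_moments _ n).1 (scheme_moments _ n).2 _ _ _ _ law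
  (@independent_theta_milstein_increment n) Xn0 iXn E1 E2.
rewrite sD sD4; apply.
- by rewrite sqrtr_gt0.
- lra.
- lra.
- by rewrite mulr_ge0 ?(ltW Delta_gt0)// subr_ge0 ler_pdivrMr// mulrC mulrA.
Qed.

(** Here 1 - rho^2 = alpha Delta (2 a + alpha Delta) / c^2, and the gap between
    the two limits factors through sigma^2 - 4 alpha mu (2 theta - 1). *)
Lemma cvg_second_moment_theta_milstein : exists L : R,
  second_moment P (Xn n) @[n --> \oo] --> L%:E /\
  (L = mu ^+ 2 + sigma ^+ 2 * mu / (2 * alpha) <->
   sigma ^+ 2 = 4 * alpha * mu * (2 * theta - 1)).
Proof.
have [m Hm] := theta_milstein_moments.
have aD : 0 < alpha * Delta by rewrite mulr_gt0.
have aDt : alpha * Delta <= alpha * theta * Delta by rewrite mulrAC ler_peMr// ltW.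
have a0 : 0 < a by lra.
have c0 : 0 < c by lra.
have ac : a < c by lra.
have cn0 : c != 0 by rewrite gt_eqF.
pose B := (2 * a * b + 4 * k * Delta + 2 * a * k * Delta) / c ^+ 2.
pose C := (b ^+ 2 + 2 * b * k * Delta + 3 * k ^+ 2 * Delta ^+ 2) / c ^+ 2.
exists ((B * mu + C) / (1 - (a / c) ^+ 2)); split.
  have E2 n : second_moment P (Xn n) = (scheme_moments m n).2%:E.
    by rewrite /second_moment unlock; have [_ _ _] := Hm n.
  under eq_fun do rewrite E2.
  apply: cvg_EFin; first by near=> n.
  apply: (@cvg_moment_recursion _ _ _ _ _ (fun n => (scheme_moments m n).1)).
  - by rewrite divr_gt0//= ltr_pdivrMr// mul1r.
  - by move=> n /=; field.
  - by move=> n /=; rewrite /B /C; field.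
have x0 : 0 < alpha * Delta * (2 * a + alpha * Delta) by rewrite mulr_gt0// addr_gt0// mulr_gt0.
have E : (B * mu + C) / (1 - (a / c) ^+ 2) - (mu ^+ 2 + sigma ^+ 2 * mu / (2 * alpha)) =
    sigma ^+ 2 * Delta ^+ 2 / 8 / (alpha * Delta * (2 * a + alpha * Delta)) *
    (sigma ^+ 2 - 4 * alpha * mu * (2 * theta - 1)).
  have -> : 1 - (a / c) ^+ 2 = alpha * Delta * (2 * a + alpha * Delta) / c ^+ 2.
    by field.
  rewrite /B /C; field.
  rewrite cn0 !gt_eqF//.
  by rewrite addr_gt0// mulr_gt0.
have K0 : sigma ^+ 2 * Delta ^+ 2 / 8 / (alpha * Delta * (2 * a + alpha * Delta)) != 0.
  by rewrite gt_eqF// divr_gt0// divr_gt0// mulr_gt0// exprn_gt0.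
split=> H.
- move: E; rewrite H subrr => /esym/eqP.
  by rewrite mulf_eq0 (negbTE K0) subr_eq0 => /eqP.
- by apply/eqP; rewrite -subr_eq0 E H subrr mulr0.
Unshelve. all: by end_near. Qed.
End scheme.

(** * Preservation of the long-term second moment *)

Unset Implicit Arguments.

Theorem theorem5p1
    (d : measure_display) (T : measurableType d) (R : realType)
    (P : probability T R)
    (alpha mu sigma Delta : R)
    (alpha_gt0 : 0 < alpha) (mu_gt0 : 0 < mu) (sigma_gt0 : 0 < sigma)
    (alpha_mu_sigma : sigma ^+ 2 <= 4 * alpha * mu) (Delta_gt0 : 0 < Delta)
    (W : R -> {RV P >-> R}) (W_wiener : wiener_process W)
    (X0 : {RV P >-> R}) (X0_ge0 : {ae P, forall w, 0 <= X0 w})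
    (X0_indep : independent P (preimages X0) (sigma_of `[0, +oo[ W))
    (X0_L2 : (second_moment P X0 < +oo)%E)
    (* the exact solution, with the known limit of its second moment *)
    (X : R -> {RV P >-> R})
    (X_cir : cir_solution alpha mu sigma W X0 X)
    (X_limit : second_moment P (X t) @[t --> +oo%R] -->
       (mu ^+ 2 + sigma ^+ 2 * mu / (2 * alpha))%:E) :
  (preserves_second_moment P
     (theta_milstein alpha mu sigma 1 Delta W X0) X
   <-> 4 * alpha * mu = sigma ^+ 2)
  /\
  (sigma ^+ 2 < 4 * alpha * mu ->
   forall theta : R, 1 <= theta ->
   ~ preserves_second_moment P
       (theta_milstein alpha mu sigma theta Delta W X0) X).
Proof.
have unique_limit theta L :
    second_moment P (theta_milstein alpha mu sigma theta Delta W X0 n)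
      @[n --> \oo] --> L%:E ->
    preserves_second_moment P
      (theta_milstein alpha mu sigma theta Delta W X0) X <->
    L = mu ^+ 2 + sigma ^+ 2 * mu / (2 * alpha).
  move=> YL; split=> [[l [Yl Xl]]|LE]; last by exists L; split => //; rewrite LE.
    have lX : l%:E = (mu ^+ 2 + sigma ^+ 2 * mu / (2 * alpha))%:E.
      by rewrite -(cvg_lim _ Xl)// -(cvg_lim _ X_limit).
    have lY : l%:E = L%:E by rewrite -(cvg_lim _ Yl)// -(cvg_lim _ YL).
    by apply: EFin_inj; rewrite -lY.
split.
  have [L [YL LE]] := cvg_second_moment_theta_milstein alpha_gt0 sigma_gt0
    alpha_mu_sigma Delta_gt0 (lexx 1) W_wiener X0_ge0 X0_indep X0_L2.
  rewrite (unique_limit _ _ YL) LE.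
  by rewrite (_ : 2 * 1 - 1 = 1) ?mulr1; [split=> ->|lra].
move=> lt_sigma theta theta_ge1.
have [L [YL LE]] := cvg_second_moment_theta_milstein alpha_gt0 sigma_gt0
  alpha_mu_sigma Delta_gt0 theta_ge1 W_wiener X0_ge0 X0_indep X0_L2.
move/(unique_limit _ _ YL)/LE => sigmaE.
suff : 4 * alpha * mu <= sigma ^+ 2 by rewrite leNgt lt_sigma.
have am_ge0 : 0 <= 4 * alpha * mu by rewrite !mulr_ge0// ltW.
by rewrite sigmaE ler_peMr//; lra.
Qed.
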